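(* Let BayesCG under the Krylov prior $\eta_0=\mathcal{N}(x_0,\Gamma_0)$, applied to $Ax_*=b$, produce the full Krylov posteriors $\eta_m=\mathcal{N}(x_m,\Gamma_m)$. Then the $Z$-statistic is equal to $$\mathrm{Z}_m(x_* )=(x_*-x_m)^T\,\Gamma_m^\dagger\,(x_*-x_m)=g-m,\qquad 1\le m\le g.$$
   Context: Let $A\in\mathbb{R}^{n\times n}$ be symmetric positive definite, $b\in\mathbb{R}^n$, $Ax_*=b$, $x_0\in\mathbb{R}^n$ an initial guess, and $r_0=b-Ax_0$ (nonzero). Let $\mathcal{K}_i(A,r_0)=\operatorname{span}\{r_0,Ar_0,\ldots,A^{i-1}r_0\}$, and let $g\le n$ be the grade of $r_0$ with respect to $A$: the minimum value with $\mathcal{K}_g(A,r_0)=\mathcal{K}_{g+i}(A,r_0)$ for all $i\ge 1$. Krylov prior: let $V=[v_1\ \cdots\ v_g]\in\mathbb{R}^{n\times g}$ satisfy $V^TAV=I_g$ and $\operatorname{span}\{v_1,\ldots,v_i\}=\mathcal{K}_i(A,r_0)$ for $1\le i\le g$; let $\phi_i=(v_i^Tr_0)^2$ and $\Phi=\operatorname{diag}(\phi_1,\ldots,\phi_g)$. The Krylov prior is $\eta_0=\mathcal{N}(x_0,\Gamma_0)$ with $\Gamma_0=V\Phi V^T$. Write $V_{i:j}=[v_i\ \cdots\ v_j]$ and $\Phi_{i:j}=\operatorname{diag}(\phi_i,\ldots,\phi_j)$, with the convention $V_{j+1:j}=0$, $\Phi_{j+1:j}=0$. The full Krylov posteriors,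 produced by BayesCG under the Krylov prior, are $\eta_m=\mathcal{N}(x_m,\Gamma_m)$ with $x_m=x_0+V_{1:m}V_{1:m}^Tr_0$ and $\Gamma_m=V_{m+1:g}\Phi_{m+1:g}V_{m+1:g}^T$ for $1\le m\le g$ (so $\Gamma_g=0$). $\Gamma^\dagger$ denotes the Moore-Penrose inverse. $\mathcal{N}(x,\Sigma)$ is the Gaussian distribution with mean $x$ and (possibly singular) covariance $\Sigma$. *)

(* Defs.v *)
From mathcomp Require Import all_boot all_order all_algebra.

Set Implicit Arguments.
Unset Strict Implicit.
Unset Printing Implicit Defensive.

Import Order.TTheory GRing.Theory Num.Theory.
Local Open Scope ring_scope.

Definition sym_posdef (R : realFieldType) (n : nat) (A : 'M[R]_n) : Prop :=
  A^T = A /\ forall x : 'cV[R]_n, x != 0 -> 0 < (x^T *m A *m x) 0 0.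

Section MoorePenrose.
Variable R : realFieldType.

(* The four Penrose equations. *)
Definition moore_penrose (m n : nat) (A : 'M[R]_(m, n)) (X : 'M[R]_(n, m)) :
    bool :=
  [&& A *m X *m A == A, X *m A *m X == X,
      (A *m X)^T == A *m X & (X *m A)^T == X *m A].

Lemma row_free_gram (r n : nat) (B : 'M[R]_(r, n)) :
  row_free B -> B *m B^T \in unitmx.
Proof.
move=> fB; rewrite -row_free_unit -kermx_eq0; apply/eqP/row_matrixP => i.
rewrite row0; set u := row i _.
have uBB : u *m (B *m B^T) = 0 by apply/sub_kermxP; apply: row_sub.
suff uB : u *m B = 0 by apply: (row_free_inj fB); rewrite uB mul0mx.
have : ((u *m B) *m (u *m B)^T) 0 0 = 0.
  by rewrite trmx_mul mulmxA -(mulmxA u) uBB mul0mx mxE.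
move: (u *m B) => w; rewrite mxE => /eqP.
rewrite psumr_eq0 => [/allP z|j _]; last by rewrite mxE -expr2 sqr_ge0.
apply/rowP => j; have := z j (mem_index_enum j).
by rewrite !mxE /= -expr2 sqrf_eq0 => /eqP.
Qed.

Lemma moore_penrose_exists (m n : nat) (A : 'M[R]_(m, n)) :
  exists X, moore_penrose A X.
Proof.
have [r [C [F [AE fC fF]]]] : exists r (C : 'M_(m, r)) (F : 'M_(r, n)),
    [/\ A = C *m F, row_free C^T & row_free F].
  exists (\rank A), (col_base A), (row_base A).
  split; [by rewrite mulmx_base | | exact: row_base_free].
  by rewrite /row_free mxrank_tr; apply: col_base_full.
have uF := row_free_gram fF.
have uC : C^T *m C \in unitmx by have := row_free_gram fC; rewrite trmxK.
set GF := invmx (F *m F^T); set GC := invmx (C^T *m C).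
have FR : F *m (F^T *m GF) = 1%:M by rewrite mulmxA mulmxV.
have CL : (GC *m C^T) *m C = 1%:M by rewrite -mulmxA mulVmx.
have GFT : GF^T = GF by rewrite /GF trmx_inv trmx_mul trmxK.
have GCT : GC^T = GC by rewrite /GC trmx_inv trmx_mul trmxK.
pose X := (F^T *m GF) *m (GC *m C^T).
have AX : A *m X = C *m (GC *m C^T).
  by rewrite AE /X -mulmxA (mulmxA F) FR mul1mx.
have XA : X *m A = F^T *m GF *m F.
  by rewrite AE /X -mulmxA (mulmxA _ C) CL mul1mx.
exists X; apply/and4P; split; apply/eqP.
- by rewrite AX AE -mulmxA (mulmxA _ C) CL mul1mx.
- by rewrite XA /X -(mulmxA _ F) (mulmxA F) FR mul1mx.
- by rewrite AX !trmx_mul trmxK GCT mulmxA.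
- by rewrite XA !trmx_mul trmxK GFT mulmxA.
Qed.

Lemma moore_penrose_unique (m n : nat) (A : 'M[R]_(m, n)) (X Y : 'M[R]_(n, m)) :
  moore_penrose A X -> moore_penrose A Y -> X = Y.
Proof.
move=> /and4P[/eqP X1 /eqP X2 /eqP X3 /eqP X4].
move=> /and4P[/eqP Y1 /eqP Y2 /eqP Y3 /eqP Y4].
have AXY : A *m X = A *m Y.
  by rewrite -X3 -{1}Y1 -(mulmxA _ A) trmx_mul X3 Y3 mulmxA X1.
have XYA : X *m A = Y *m A.
  by rewrite -X4 -{1}Y1 -mulmxA mulmxA trmx_mul X4 Y4 -mulmxA (mulmxA A) X1.
by rewrite -X2 XYA -mulmxA AXY mulmxA Y2.
Qed.

Definition mpinv (m n : nat) (A : 'M[R]_(m, n)) : 'M[R]_(n, m) :=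
  xchoose (moore_penrose_exists A).

Lemma mpinvP (m n : nat) (A : 'M[R]_(m, n)) : moore_penrose A (mpinv A).
Proof. exact: xchooseP. Qed.

End MoorePenrose.

Section KrylovPosterior.
Variables (R : realFieldType) (n : nat).

Definition krylov (A : 'M[R]_n) (r : 'cV[R]_n) (i : nat) : {vspace 'cV[R]_n} :=
  <<mkseq (fun j => A ^+ j *m r) i>>%VS.

Definition krylov_stable (A : 'M[R]_n) (r : 'cV[R]_n) (h : nat) : Prop :=
  forall i : nat, (1 <= i)%N -> krylov A r h = krylov A r (h + i).

Definition is_grade (A : 'M[R]_n) (r : 'cV[R]_n) (g : nat) : Prop :=
  krylov_stable A r g /\ forall h : nat, krylov_stable A r h -> (g <= h)%N.

(* The columns of V are numbered from 0: the k-th vector v_k is the column of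
   index k.-1, and (k < i)%N below selects v_1, ..., v_i. *)
Definition krylov_basis (A : 'M[R]_n) (r : 'cV[R]_n) (g : nat)
    (V : 'M[R]_(n, g)) : Prop :=
  V^T *m A *m V = 1%:M /\
  forall i : nat, (1 <= i <= g)%N ->
    <<[seq col k V | k : 'I_g <- enum 'I_g & (k < i)%N]>>%VS = krylov A r i.

(* Columns i, ..., j (numbered from 1) of M.  For i = j.+1 the result has no
   column, so that the products in which it occurs vanish.  The default value 0
   is only taken outside the range 1 <= i, j <= g. *)
Definition col_range (p g : nat) (M : 'M[R]_(p, g)) (i j : nat) :
    'M[R]_(p, j.+1 - i) :=
  \matrix_(k, l) oapp (fun c : 'I_g => M k c) 0 (insub (i + l).-1).

Definition phi (r : 'cV[R]_n) (g : nat) (V : 'M[R]_(n, g)) : 'rV[R]_g :=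
  \row_k ((col k V)^T *m r) 0 0 ^+ 2.

(* A Gaussian N(mean, cov), possibly with singular covariance, is represented by
   its two parameters, which determine it. *)
Record gaussian := Gaussian { mean : 'cV[R]_n; cov : 'M[R]_n }.

Definition krylov_prior (x0 r0 : 'cV[R]_n) (g : nat) (V : 'M[R]_(n, g)) :
    gaussian :=
  Gaussian x0 (V *m diag_mx (phi r0 V) *m V^T).

Definition full_krylov_posterior (x0 r0 : 'cV[R]_n) (g : nat)
    (V : 'M[R]_(n, g)) (m : nat) : gaussian :=
  let V1 := col_range V 1 m in
  let V2 := col_range V m.+1 g in
  Gaussian (x0 + V1 *m V1^T *m r0)
           (V2 *m diag_mx (col_range (phi r0 V) m.+1 g) *m V2^T).

Definition Zstat (eta : gaussian) (x : 'cV[R]_n) : R :=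
  ((x - mean eta)^T *m mpinv (cov eta) *m (x - mean eta)) 0 0.

Lemma full_krylov_posterior0 (x0 r0 : 'cV[R]_n) (g : nat) (V : 'M[R]_(n, g)) :
  full_krylov_posterior x0 r0 V 0 = krylov_prior x0 r0 V.
Proof.
rewrite /full_krylov_posterior /krylov_prior; congr Gaussian.
  suff -> : forall M : 'M[R]_(n, 1 - 1), M *m M^T *m r0 = 0 by rewrite addr0.
  by move=> M; apply/matrixP => i j; rewrite !mxE big1 // => k _;
     rewrite !mxE big_ord0 mul0r.
have E p (M : 'M[R]_(p, g)) :
    col_range M 1 g = castmx (erefl p, esym (subn1 g.+1)) M.
  apply/matrixP => k l; rewrite castmxE !mxE add1n /=.
  rewrite insubT /= => [|lt]; first by rewrite -{2}[g]/(g.+1.-1) -subn1.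
  by congr (M _ _); apply: val_inj.
rewrite !E.
by case: _ / (esym (subn1 g.+1)); rewrite !castmx_id.
Qed.

End KrylovPosterior.

(* Main.v *)
Require Import Defs.
From mathcomp Require Import all_boot all_order all_algebra.

Set Implicit Arguments.
Unset Strict Implicit.
Unset Printing Implicit Defensive.

Import Order.TTheory GRing.Theory Num.Theory.
Local Open Scope ring_scope.

(** Write [u = V^T r0], so that [phi_k = u_k ^ 2].

    The error [xs - x0] is [V V^T r0] ([error_krylov_expansion]): the residual
    of the Galerkin approximation [x0 + V V^T r0] lies in the Krylov space of
    index the grade, which is stable under [A], and is orthogonal to that same
    space, so it is zero.  Hence [xs - x_m] is [V2 u2], where [V2] and [u2] keep
    the indices above [m].

    No [u_k] is zero ([krylov_basis_residual_neq0]): [v_k] is orthogonal to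
    [A K_(k-1)], and [K_k] is spanned by [r0] and [A K_(k-1)], so [v_k], which
    lies in [K_k], would be orthogonal to itself.

    Consequently, with [D = diag (u2 ^ 2)] and [z] the entrywise inverse of [u2],
    [D z = u2] and, since [V2^T A V2 = 1], the vector [w = A V2 z] satisfies
    [Gamma_m w = V2 D z = xs - x_m].  On the range of a symmetric matrix the
    form of the Moore-Penrose inverse pulls back to the form of the matrix
    itself ([mpinv_quadratic_form]), so the statistic is
    [w^T Gamma_m w = z^T u2], a sum of [g - m] ones. *)

(** * Linear algebra *)

Lemma mulmx_span (R : fieldType) (p n : nat) (M : 'M[R]_(p, n))
    (X : seq 'cV[R]_n) (U : {vspace 'cV[R]_p}) (x : 'cV[R]_n) :
  (forall v, v \in X -> M *m v \in U) -> x \in <<X>>%VS -> M *m x \in U.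
Proof.
move=> XU; have sXU : (<<X>> <= linfun (mulmx M) @^-1: U)%VS.
  by apply/span_subvP => v /XU; rewrite -memv_preim lfunE.
by move/(subvP sXU); rewrite -memv_preim lfunE.
Qed.

Lemma mulmx_span0 (R : fieldType) (p n : nat) (M : 'M[R]_(p, n))
    (X : seq 'cV[R]_n) (x : 'cV[R]_n) :
  (forall v, v \in X -> M *m v = 0) -> x \in <<X>>%VS -> M *m x = 0.
Proof.
move=> X0 xX; apply/eqP; rewrite -memv0; apply: mulmx_span xX => v /X0 ->.
exact: mem0v.
Qed.

Lemma cV_self_orthogonal (R : realFieldType) (n : nat) (x : 'cV[R]_n) :
  x^T *m x = 0 -> x = 0.
Proof.
move/matrixP/(_ 0 0); rewrite !mxE => /eqP.
rewrite psumr_eq0 => [/allP z|j _]; last by rewrite mxE -expr2 sqr_ge0.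
apply/colP => j; have := z j (mem_index_enum j).
by rewrite !mxE /= -expr2 sqrf_eq0 => /eqP.
Qed.

Lemma sym_posdef_inj (R : realFieldType) (n : nat) (A : 'M[R]_n)
    (x y : 'cV[R]_n) :
  sym_posdef A -> A *m x = A *m y -> x = y.
Proof.
move=> [_ pd] Axy; apply/eqP; rewrite -subr_eq0; apply: contraT => /pd.
by rewrite -mulmxA mulmxBr Axy subrr mulmx0 mxE ltxx.
Qed.

(** Only the Penrose equation [S S^+ S = S] enters: the outer factors [w^T S] and
    [S w] supply the two copies of [S] around the inverse. *)
Lemma mpinv_quadratic_form (R : realFieldType) (n : nat) (S : 'M[R]_n)
    (w : 'cV[R]_n) :
  S^T = S -> (S *m w)^T *m mpinv S *m (S *m w) = w^T *m S *m w.
Proof.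
move=> symS; have /and4P[/eqP SXS _ _ _] := mpinvP S.
by rewrite trmx_mul symS -[in RHS]SXS !mulmxA.
Qed.

(** * Column ranges *)

(** Describing a column range as a selection of columns by an injection lets
    products of column ranges be computed as submatrices of products. *)
Lemma col_range_colsub (R : realFieldType) (g i : nat) :
  exists2 f : 'I_(g.+1 - i.+1) -> 'I_g, injective f &
    forall p (M : 'M[R]_(p, g)), col_range M i.+1 g = colsub f M.
Proof.
have lt (l : 'I_(g.+1 - i.+1)) : (i + l < g)%N.
  by have := ltn_ord l; rewrite [X in (_ < X)%N]subSS ltn_subRL.
exists (fun l => Ordinal (lt l)) => [l1 l2 [/addnI] /val_inj //|p M].
apply/matrixP => k l; rewrite !mxE (insubT (fun c => c < g)%N (lt l)) /=.
by congr (M _ _); apply: val_inj.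
Qed.

Lemma col_range_gramE (R : realFieldType) (p g i j : nat) (M : 'M[R]_(p, g))
    (a b : 'I_p) :
  (col_range M i.+1 j *m (col_range M i.+1 j)^T) a b =
  \sum_(i <= k < j) oapp (fun c : 'I_g => M a c * M b c) 0 (insub k).
Proof.
rewrite mxE -[X in index_iota X]add0n big_addn -[(j - i)%N]subSS big_mkord.
apply: eq_bigr => l _; rewrite !mxE addSn /= addnC.
by case: insub => [c|] //=; rewrite mul0r.
Qed.

Lemma gram_col_range_split (R : realFieldType) (p g m : nat)
    (M : 'M[R]_(p, g)) :
  (m <= g)%N ->
  M *m M^T = col_range M 1 m *m (col_range M 1 m)^T
             + col_range M m.+1 g *m (col_range M m.+1 g)^T.
Proof.
move=> mg; apply/matrixP => a b.
rewrite [in RHS]mxE !col_range_gramE -big_cat_nat //= big_mkord mxE.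
by apply: eq_bigr => c _; rewrite valK /= !mxE.
Qed.

(** * Krylov spaces *)

Lemma mem_krylov (R : realFieldType) (n : nat) (A : 'M[R]_n) (r : 'cV[R]_n)
    (i j : nat) :
  (j < i)%N -> A ^+ j *m r \in krylov A r i.
Proof. by move=> ji; apply/memv_span/map_f; rewrite mem_iota. Qed.

Lemma mul_krylov (R : realFieldType) (n : nat) (A : 'M[R]_n)
    (r x : 'cV[R]_n) (i : nat) :
  x \in krylov A r i -> A *m x \in krylov A r i.+1.
Proof.
apply: mulmx_span => v /mapP[j]; rewrite mem_iota => /andP[_ ji] ->.
by rewrite mulmxA mulmxE -exprS mem_krylov.
Qed.

Section KrylovBasis.
Variables (R : realFieldType) (n g : nat) (A : 'M[R]_n) (r : 'cV[R]_n).
Variable V : 'M[R]_(n, g).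
Hypothesis Vbasis : krylov_basis A r V.

Lemma krylov_basis_colP (k l : 'I_g) :
  (col k V)^T *m A *m col l V = (k == l)%:R%:M.
Proof.
have [VAV _] := Vbasis.
rewrite tr_col -row_mul colE mulmxA -row_mul VAV -colE.
by apply/matrixP => i j; rewrite !ord1 !mxE eqxx mulr1n.
Qed.

Lemma col_krylov (k : 'I_g) : col k V \in krylov A r k.+1.
Proof.
have [_ <-] := Vbasis; last exact: ltn_ord.
by apply/memv_span/map_f; rewrite mem_filter ltnSn mem_enum.
Qed.

Lemma krylov_basis_span :
  (0 < g)%N -> <<[seq col k V | k <- enum 'I_g]>>%VS = krylov A r g.
Proof.
move=> g0; have [_ <-] := Vbasis; last by rewrite g0 leqnn.
by congr <<map _ _>>%VS; apply/esym/all_filterP/allP => k _.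
Qed.

(** If [v_k] were orthogonal to [r], then, being [A]-orthogonal to the preceding
    Krylov space, it would be orthogonal to every generator [A^j r] of the space
    that contains it, hence zero, against [v_k^T A v_k = 1]. *)
Lemma krylov_basis_residual_neq0 (k : 'I_g) : (V^T *m r) k 0 != 0.
Proof.
apply/eqP => vr0; have vr : (col k V)^T *m r = 0.
  by apply/matrixP => i j; rewrite !ord1 tr_col -row_mul !mxE -[RHS]vr0 mxE.
have vK x : x \in krylov A r k -> (col k V)^T *m A *m x = 0.
  (* The spanning condition is only given for positive indices. *)
  have [k0|k_gt0] := posnP k.
    by rewrite /krylov k0 span_nil memv0 => /eqP ->; rewrite mulmx0.
  have [_ <-] := Vbasis; last by rewrite k_gt0 ltnW.
  apply: mulmx_span0 => v /mapP[l]; rewrite mem_filter => /andP[lk _] ->.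
  by rewrite krylov_basis_colP -val_eqE gtn_eqF //= raddf0.
have v0 : col k V = 0.
  apply/cV_self_orthogonal; apply: mulmx_span0 (col_krylov k) => v /mapP[j].
  rewrite mem_iota => /andP[_ jk] ->; case: j jk => [|j] jk.
    by rewrite expr0 mul1mx.
  by rewrite exprS -mulmxE !mulmxA -(mulmxA _ _ r) vK // mem_krylov.
have /matrixP/(_ 0 0)/eqP := krylov_basis_colP k k.
by rewrite v0 mulmx0 eqxx !mxE eqxx eq_sym oner_eq0.
Qed.

(** The difference [r - A V V^T r] lies in the Krylov space of index [g], by
    stability, and [V^T] kills it since [V^T A V = 1]; being orthogonal to the
    space that contains it, it vanishes. *)
Lemma galerkin_residual0 :
  (0 < g)%N -> krylov_stable A r g -> A *m (V *m V^T *m r) = r.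
Proof.
move=> g0 stab; apply/esym/eqP; rewrite -subr_eq0; apply/eqP.
set d := r - _; have [VAV _] := Vbasis.
have Vd : V^T *m d = 0 by rewrite mulmxBr !mulmxA VAV mul1mx subrr.
have dK : d \in krylov A r g.
  apply: rpredB; first by have := mem_krylov A r g0; rewrite expr0 mul1mx.
  rewrite (stab 1%N) // addn1 mul_krylov // -krylov_basis_span // -mulmxA.
  have -> (c : 'cV[R]_g) : V *m c = \sum_k c k 0 *: col k V.
    apply/colP => i; rewrite mxE summxE.
    by apply: eq_bigr => k _; rewrite !mxE mulrC.
  by apply: rpred_sum => k _; apply/rpredZ/memv_span/map_f; rewrite mem_enum.
apply: cV_self_orthogonal; move: (dK); rewrite -krylov_basis_span //.
apply: mulmx_span0 => v /mapP[k _ ->]; apply: trmx_inj.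
by rewrite trmx_mul trmxK tr_col -row_mul Vd row0 trmx0.
Qed.

Lemma error_krylov_expansion (e : 'cV[R]_n) :
  sym_posdef A -> (0 < g)%N -> krylov_stable A r g -> A *m e = r ->
  e = V *m V^T *m r.
Proof.
move=> pdA g0 st Ae; apply: (sym_posdef_inj pdA).
by rewrite Ae galerkin_residual0.
Qed.

End KrylovBasis.

(** * The statistic *)

(** When the squared coefficients of a vector in the columns of [W] are the
    weights of the covariance, every direction contributes
    [u_k ^ 2 / u_k ^ 2 = 1].  The left inverse [B^T] of [W] serves to write [W u]
    as the image under the covariance of [B z], where [z_k = 1 / u_k]; for a
    Krylov basis [B] is [A W], since the columns of [W] are orthonormal for the
    inner product of [A] only. *)
Lemma mpinv_form_squared_weights (R : realFieldType) (n q : nat)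
    (W B : 'M[R]_(n, q)) (u : 'cV[R]_q) (d : 'rV[R]_q) :
  B^T *m W = 1%:M -> (forall k, u k 0 != 0) ->
  (forall k, d 0 k = u k 0 ^+ 2) ->
  ((W *m u)^T *m mpinv (W *m diag_mx d *m W^T) *m (W *m u)) 0 0 = q%:R.
Proof.
move=> BW u0 dE; set S := W *m _ *m _.
have WB : W^T *m B = 1%:M by rewrite -[LHS]trmxK trmx_mul trmxK BW trmx1.
pose z : 'cV[R]_q := \col_k (u k 0)^-1.
have Dz : diag_mx d *m z = u.
  by apply/colP => k; rewrite mul_diag_mx !mxE dE expr2 mulfK.
have Sw : S *m (B *m z) = W *m u.
  by rewrite /S -!mulmxA (mulmxA W^T) WB mul1mx Dz.
have symS : S^T = S by rewrite /S !trmx_mul trmxK tr_diag_mx mulmxA.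
rewrite -Sw mpinv_quadratic_form // -mulmxA Sw trmx_mul -mulmxA (mulmxA _ W) BW.
rewrite mul1mx mxE (eq_bigr (fun=> 1)) => [|k _]; last by rewrite !mxE mulVf.
by rewrite sumr_const card_ord.
Qed.

Theorem theorem29 (R : realFieldType) (n : nat) (A : 'M[R]_n)
    (b xs x0 r0 : 'cV[R]_n) (g : nat) (V : 'M[R]_(n, g)) :
  sym_posdef A ->
  A *m xs = b ->
  r0 = b - A *m x0 ->
  r0 != 0 ->
  is_grade A r0 g ->
  krylov_basis A r0 V ->
  forall m : nat, (1 <= m <= g)%N ->
    Zstat (full_krylov_posterior x0 r0 V m) xs = g%:R - m%:R.
Proof.
move=> pdA Axs r0E _ [stab _] Vb m /andP[m0 mg].
have e0 : xs - x0 = V *m V^T *m r0.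
  apply: (error_krylov_expansion Vb) => //; first exact: leq_trans m0 mg.
  by rewrite mulmxBr Axs -r0E.
rewrite /Zstat /= opprD addrA e0 (gram_col_range_split V mg) mulmxDl addrAC.
rewrite subrr add0r -(mulmxA (col_range V _ _)) -natrB // -[in RHS]subSS.
have [f finj fE] := col_range_colsub R g m; rewrite !fE.
have VfE k : ((colsub f V)^T *m r0) k 0 = (V^T *m r0) (f k) 0.
  by rewrite !mxE; apply: eq_bigr => l _; rewrite !mxE.
apply: (@mpinv_form_squared_weights _ _ _ _ (A^T *m colsub f V)) => [|k|k].
- rewrite trmx_mul trmxK.
  have [VAV _] := Vb.
  have -> : (colsub f V)^T *m A *m colsub f V = mxsub f f (V^T *m A *m V).
    by rewrite mxsub_mul -mul_rowsub_mx // trmx_mxsub.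
  by rewrite VAV; apply/matrixP => i j; rewrite !mxE (inj_eq finj).
- by rewrite VfE (krylov_basis_residual_neq0 Vb).
- rewrite VfE !mxE; congr (_ ^+ 2).
  by apply: eq_bigr => l _; rewrite !mxE.
Qed.
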